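(* Let $n\ge1$, let $H\in\mathbb{R}^{n\times n}$ be symmetric positive definite with symmetric positive-definite square root $H^{1/2}$, and let $\delta>0$. Let $\mathbb B_{n+1}=\{(\xi_0,\xi)\in\mathbb{R}\times\mathbb{R}^n:\xi_0^2+\|\xi\|^2\le1\}$. For $(t,z)\in\mathbb{R}\times\mathbb{R}^n$, the robust constraint $$\delta\xi_0+\xi^{\mathsf T}H^{1/2}z\le t\qquad\text{for every }(\xi_0,\xi)\in\mathbb B_{n+1}$$ is equivalent to $(t,z)\in C_{\delta,H}$, where $C_{\delta,H}=\{(t,z)\in\mathbb{R}\times\mathbb{R}^n: t\ge\sqrt{\delta^2+z^{\mathsf T}Hz}\}$.
   Context: $\|\cdot\|$ is the Euclidean norm. *)

(* Defs.v *)
From HB Require Import structures.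
From mathcomp Require Import all_boot all_order all_algebra.
From mathcomp Require Import boolp classical_sets reals.

Set Implicit Arguments.
Unset Strict Implicit.
Unset Printing Implicit Defensive.

Import Order.TTheory GRing.Theory Num.Theory.

Local Open Scope ring_scope.
Local Open Scope classical_set_scope.

(* The library norm `|x| on matrices is the sup norm, hence a separate
   Euclidean norm. *)
Definition enorm (R : realType) (n : nat) (x : 'cV[R]_n) : R :=
  Num.sqrt (\sum_(i < n) x i 0 ^+ 2).

(* The scalar x^T A y: the unique entry of a 1 x 1 matrix. *)
Definition mxform (R : realType) (n : nat) (A : 'M[R]_n) (x y : 'cV[R]_n) : R :=
  (x^T *m A *m y) 0 0.

Definition sym_posdef (R : realType) (n : nat) (A : 'M[R]_n) : Prop :=
  A \is symmetricmx /\ forall x : 'cV[R]_n, x != 0 -> 0 < mxform A x x.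

(* S = H^{1/2}; such an S is unique when H is symmetric positive definite. *)
Definition is_posdef_sqrt (R : realType) (n : nat) (H S : 'M[R]_n) : Prop :=
  sym_posdef S /\ S *m S = H.

(* The closed unit ball of R x R^n, i.e. of R^(n+1). *)
Definition unit_ball (R : realType) (n : nat) : set (R * 'cV[R]_n) :=
  [set p | p.1 ^+ 2 + enorm p.2 ^+ 2 <= 1].

Definition cone_set (R : realType) (n : nat) (delta : R) (H : 'M[R]_n) :
    set (R * 'cV[R]_n) :=
  [set p | p.1 >= Num.sqrt (delta ^+ 2 + mxform H p.2 p.2)].

(* Main.v *)
(* Put w = H^{1/2} z and N = sqrt (delta^2 + z^T H z), so that N is the
   Euclidean norm of (delta, w).  The left-hand side of the constraint is the
   scalar product of (xi0, xi) with (delta, w): it is at most N on the unit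
   ball (summing a b <= (N a^2 + b^2 / N) / 2 over the coordinates), and equals
   N at (delta, w) / N. *)
Require Import Defs.
From HB Require Import structures.
From mathcomp Require Import all_boot all_order all_algebra.
From mathcomp Require Import boolp classical_sets reals.
From mathcomp Require Import ring lra.

Import Order.TTheory GRing.Theory Num.Theory.

Local Open Scope ring_scope.

Lemma enorm_sqr (R : realType) (n : nat) (x : 'cV[R]_n) :
  enorm x ^+ 2 = \sum_(i < n) x i 0 ^+ 2.
Proof. by rewrite sqr_sqrtr // sumr_ge0 // => i _; exact: sqr_ge0. Qed.

Lemma mxform_dot (R : realType) (n : nat) (A : 'M[R]_n) (x y : 'cV[R]_n) :
  mxform A x y = \sum_(i < n) x i 0 * (A *m y) i 0.
Proof.
by rewrite /mxform -mulmxA mxE; apply: eq_bigr => i _; rewrite mxE.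
Qed.

(** By symmetry one factor [S] moves onto the left vector, as [S^T]. *)
Lemma mxform_sqr (R : realType) (n : nat) (S : 'M[R]_n) (z : 'cV[R]_n) :
  S \is symmetricmx -> mxform (S *m S) z z = enorm (S *m z) ^+ 2.
Proof.
(* Symmetric means Hermitian with sign [(-1) ^+ 0] and the identity as conjugation; clearing both
   leaves [S = S^T]. *)
move=> /is_hermitianmxP; rewrite expr0 scale1r map_mx_id // => symS.
rewrite enorm_sqr /mxform.
have -> : z^T *m (S *m S) *m z = (S *m z)^T *m (S *m z).
  by rewrite trmx_mul -symS !mulmxA.
by rewrite mxE; apply: eq_bigr => i _; rewrite mxE expr2.
Qed.

(** The gap is a multiple of [(N * a - b) ^+ 2]. It vanishes at [a = b / N], so the bound is tight
    at the maximiser. *)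
Lemma young_scaled (R : realType) (N a b : R) : 0 < N ->
  a * b <= (N * a ^+ 2 + N^-1 * b ^+ 2) / 2.
Proof.
move=> N_gt0; rewrite -subr_ge0.
have -> : (N * a ^+ 2 + N^-1 * b ^+ 2) / 2 - a * b = N^-1 * (N * a - b) ^+ 2 / 2.
  by field; rewrite gt_eqF.
by rewrite divr_ge0 // mulr_ge0 ?sqr_ge0 // invr_ge0 ltW.
Qed.

Theorem proposition9p1 (R : realType) (n : nat) (n_ge1 : (1 <= n)%N)
    (H Hhalf : 'M[R]_n) (H_spd : sym_posdef H)
    (Hhalf_sqrt : is_posdef_sqrt H Hhalf)
    (delta : R) (delta_gt0 : 0 < delta) (t : R) (z : 'cV[R]_n) :
  (forall (xi0 : R) (xi : 'cV[R]_n), unit_ball (xi0, xi) ->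
      delta * xi0 + mxform Hhalf xi z <= t)
  <-> cone_set delta H (t, z).
Proof.
case: Hhalf_sqrt => -[symS _] SS.
rewrite /cone_set /unit_ball /= -SS (mxform_sqr _ _ _ _ symS).
set w := Hhalf *m z; set N := Num.sqrt _.
(* Since [0 < delta], [N] is positive even when [z = 0], which permits dividing by [N]. *)
have q_gt0 : 0 < delta ^+ 2 + enorm w ^+ 2.
  by rewrite ltr_wpDr ?sqr_ge0 // exprn_gt0.
have N_gt0 : 0 < N by rewrite sqrtr_gt0.
have N0 : N != 0 by rewrite gt_eqF.
have NN : delta ^+ 2 + enorm w ^+ 2 = N ^+ 2 by rewrite (sqr_sqrtr (ltW q_gt0)).
split=> [constr | leNt xi0 xi ball].
- have norm1 : (delta / N) ^+ 2 + enorm (N^-1 *: w) ^+ 2 = 1.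
    have -> : enorm (N^-1 *: w) ^+ 2 = N^-1 ^+ 2 * enorm w ^+ 2.
      rewrite !enorm_sqr mulr_sumr; apply: eq_bigr => i _.
      by rewrite mxE exprMn.
    by rewrite exprMn mulrC -mulrDr NN -exprMn mulVf ?expr1n.
  have valN : delta * (delta / N) + mxform Hhalf (N^-1 *: w) z = N.
    have -> : mxform Hhalf (N^-1 *: w) z = N^-1 * enorm w ^+ 2.
      rewrite mxform_dot enorm_sqr mulr_sumr; apply: eq_bigr => i _.
      by rewrite mxE -mulrA expr2.
    by rewrite mulrA -expr2 mulrC -mulrDr NN expr2 mulKf.
  by rewrite -valN; apply: constr; rewrite norm1.
- apply: le_trans leNt.
  have le_form : mxform Hhalf xi z
      <= (N * enorm xi ^+ 2 + N^-1 * enorm w ^+ 2) / 2.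
    rewrite mxform_dot !enorm_sqr !mulr_sumr -big_split /= mulr_suml.
    by apply: ler_sum => i _; exact: young_scaled.
  have le_delta := young_scaled _ N xi0 delta N_gt0.
  have le_ball := ler_wpM2l (ltW N_gt0) ball.
  have Nq : N^-1 * (delta ^+ 2 + enorm w ^+ 2) = N by rewrite NN expr2 mulKf.
  (* Adding [le_form] and [le_delta] bounds the left side by half of
     [N * (xi0 ^+ 2 + enorm xi ^+ 2)] plus half of [N^-1 * (delta ^+ 2 + enorm w ^+ 2)]; each half
     is at most [N / 2], by [le_ball] and [Nq]. *)
  lra.
Qed.
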